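(* We have \[ \sigma_p(\mathcal A|_{H_1\times H_1})\subset W^2(\mathcal A|_{H_1\times H_1}),\qquad \sigma_{ap}(\mathcal A|_{H_1\times H_1})\subset\overline{W^2(\mathcal A|_{H_1\times H_1})}, \] and hence \[ \sigma_p(\mathcal A)\subset\overline{W^2(\mathcal A|_{H_1\times H_1})},\qquad \sigma_{ap}(\mathcal A)\subset\overline{W^2(\mathcal A|_{H_1\times H_1})}. \]
   Context: $H$ is a (complex) Hilbert space with inner product $\langle\cdot,\cdot\rangle$ and norm $\|\cdot\|$. $A_0:\mathcal D(A_0)\subset H\to H$ is a self-adjoint, uniformly positive linear operator with $0\in\rho(A_0)$. $H_{1/2}:=\mathcal D(A_0^{1/2})$ with norm $\|z\|_{H_{1/2}}=\|A_0^{1/2}z\|$ and inner product $\langle x,y\rangle_{H_{1/2}}=\langle A_0^{1/2}x,A_0^{1/2}y\rangle$; $H_{-1/2}$ is the dual of $H_{1/2}$ with respect to the pivot space $H$, i.e. the completion of $H$ with respect to $\|A_0^{-1/2}z\|$; $\langle\cdot,\cdot\rangle_{H_{-1/2}\times H_{1/2}}$ is the duality pairing, with $\langle z',z\rangle_{H_{-1/2}\times H_{1/2}}=\langle z',z\rangle$ for $z'\in H$, $z\in H_{1/2}$. $H_1:=\mathcal D(A_0)$. $A_0$ extends to a bounded operator $H_{1/2}\to H_{-1/2}$, again denoted $A_0$. $D:H_{1/2}\to H_{-1/2}$ is a bounded linear operator such that $\mathrm{Re}\,\langle Dz,z\rangle_{H_{-1/2}\times H_{1/2}}\ge 0$ for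 all $z\in H_{1/2}$, and $D$ maps $H_1$ into $H$. The operator $\mathcal A$ in $H_{1/2}\times H$ is $\mathcal A=\begin{bmatrix}0&I\\-A_0&-D\end{bmatrix}$ with $\mathcal D(\mathcal A)=\{(z,w)^\top\in H_{1/2}\times H_{1/2}\mid A_0z+Dw\in H\}\supset H_1\times H_1$. Quadratic numerical range: for $f,g\in H_1\setminus\{0\}$ let \[ \mathcal A_{f,g}=\begin{bmatrix}0&\frac{\langle g,f\rangle_{H_{1/2}}}{\|f\|_{H_{1/2}}\|g\|}\\[1ex]-\frac{\langle A_0f,g\rangle}{\|f\|_{H_{1/2}}\|g\|}&-\frac{\langle Dg,g\rangle}{\|g\|^2}\end{bmatrix}\in M_2(\mathbb C), \] and let $W^2(\mathcal A|_{H_1\times H_1})$ be the set of all eigenvalues of all matrices $\mathcal A_{f,g}$, $f,g\in H_1\setminus\{0\}$. $\sigma_p(S)$ is the set of eigenvalues of $S$; $\sigma_{ap}(S)$ is the set of $\lambda\in\mathbb C$ for which there is a sequence $(x_n)$ in $\mathcal D(S)$ with $\|x_n\|=1$ and $\|(S-\lambda)x_n\|\to0$. *)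

(* Defs.v *)
From HB Require Import structures.
From mathcomp Require Import all_boot all_order all_algebra.
From mathcomp Require Import complex.
From mathcomp Require Import all_classical all_reals all_analysis.

Set Implicit Arguments.
Unset Strict Implicit.
Unset Printing Implicit Defensive.

Import Order.TTheory GRing.Theory Num.Theory.
Import numFieldNormedType.Exports.
Local Open Scope classical_set_scope.
Local Open Scope ring_scope.

(* Only the values of app on dom are meaningful. *)
Record operator (U V : Type) := Operator { dom : set U; app :> U -> V }.

Record linear_operator (C : nzRingType) (U V : lmodType C) := LinearOperator {
  op_base :> operator U V;
  op_dom0 : dom op_base 0;
  op_domP : forall a x y, dom op_base x -> dom op_base y ->
    dom op_base (a *: x + y);
  op_linearP : forall a x y, dom op_base x -> dom op_base y ->
    op_base (a *: x + y) = a *: op_base x + op_base y }.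

Definition graph U V (T : operator U V) : set (U * V) :=
  [set p | dom T p.1 /\ T p.1 = p.2].

Definition restriction U V (T : operator U V) (E : set U) : operator U V :=
  Operator E T.

Section Domain.
Variables (C : nzRingType) (U V : lmodType C) (T : linear_operator U V).

Definition dom_pred : {pred U} := fun x => x \in dom T.

Lemma dom_pred_submod : submod_closed dom_pred.
Proof.
split; first by rewrite unfold_in; apply/mem_set/op_dom0.
move=> a x y; rewrite !unfold_in => /set_mem Tx /set_mem Ty.
exact/mem_set/op_domP.
Qed.

HB.instance Definition _ := GRing.isSubmodClosed.Build C U dom_pred
  dom_pred_submod.

Record domain := Domain { dval : U; dvalP : dval \in dom_pred }.

HB.instance Definition _ := [isSub for dval].
HB.instance Definition _ := [Choice of domain by <:].
HB.instance Definition _ := [SubChoice_isSubLmodule of domain by <:].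

End Domain.

Section Spectrum.
Variables (C : numClosedFieldType) (V : lmodType C).

Definition point_spectrum (T : operator V V) : set C :=
  [set l | exists x, [/\ dom T x, x != 0 & T x = l *: x]].

Definition approximate_point_spectrum (nrm : V -> C) (T : operator V V) :
    set C :=
  [set l | exists x : nat -> V, [/\ forall n, dom T (x n),
    forall n, nrm (x n) = 1 &
    (fun n => nrm (T (x n) - l *: x n)) @ \oo --> (0 : C)]].

End Spectrum.

Definition bounded_map (C : numDomainType) (U V : Type)
    (nU : U -> C) (nV : V -> C) (f : U -> V) :=
  exists M : C, forall x, nV (f x) <= M * nU x.

Section Hilbert.
Variables (C : numClosedFieldType) (H : normedModType C).

(* Forms in {dot H for Num.conj} are linear in the first argument and
   antilinear in the second. *)
Variable dot : {dot H for Num.conj}.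

Definition adjoint_graph (T : operator H H) : set (H * H) :=
  [set p | forall x, dom T x -> dot (T x) p.1 = dot x p.2].

Definition self_adjoint (T : operator H H) :=
  dense (dom T) /\ graph T = adjoint_graph T.

Definition uniformly_positive (T : operator H H) :=
  exists c : C, 0 < c /\
    forall x, dom T x -> c * `|x| ^+ 2 <= dot (T x) x.

Definition resolvent_set (T : operator H H) : set C :=
  [set l | exists B : {linear H -> H}, [/\ bounded_map Num.norm Num.norm B,
    forall y, dom T (B y) /\ T (B y) - l *: B y = y &
    forall x, dom T x -> B (T x - l *: x) = x]].

Definition positive_sqrt (T S : operator H H) :=
  [/\ self_adjoint S, forall x, dom S x -> 0 <= dot (S x) x,
    dom T = [set x | dom S x /\ dom S (S x)] &
    forall x, dom T x -> S (S x) = T x].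

End Hilbert.

Definition is_completion (C : numClosedFieldType) (H : lmodType C)
    (nrm : H -> C) (Hm : completeNormedModType C) (j : {linear H -> Hm}) :=
  (forall z, `|j z| = nrm z) /\ dense (range j).

Section SecondOrder.
Variables (C : numClosedFieldType) (H : completeNormedModType C).
Variables (dot : {dot H for Num.conj}) (A0 S : linear_operator H H).
Variables (Hm : completeNormedModType C) (j : {linear H -> Hm}).

(* Throughout, S stands for A_0^(1/2), j for the embedding of H into
   H_(-1/2) = Hm, and Hhalf is H_(1/2). *)
Definition Hhalf := domain S.

Definition half_dot (x y : Hhalf) : C := dot (S (val x)) (S (val y)).

Definition half_norm (x : Hhalf) : C := `|S (val x)|.

Definition minus_half_norm (z : H) : C := `|'pinv_(fun=> 0) (dom S) S z|.

(* The extension by continuity to Hm of the inner product of H. *)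
Definition is_duality_pairing (pairing : Hm -> Hhalf -> C) :=
  (forall z, continuous (pairing^~ z)) /\
  (forall x z, pairing (j x) z = dot x (val z)).

Definition H1 : set H := dom A0.

Definition extends_A0 (A0e : Hhalf -> Hm) :=
  forall z : Hhalf, H1 (val z) -> A0e z = j (A0 (val z)).

Variables (A0e D : {linear Hhalf -> Hm}).

(* j is injective, so that it identifies H with a subspace of Hm; this maps an
   element of that subspace to the element of H it is identified with. *)
Definition in_H : Hm -> H := 'pinv_(fun=> 0) setT j.

Definition block_op : operator (Hhalf * H) (Hhalf * H) :=
  Operator
    [set x | exists w : Hhalf, val w = x.2 /\ range j (A0e x.1 + D w)]
    (fun x => let w : Hhalf := insubd 0 x.2 in (w, in_H (- A0e x.1 - D w))).

Definition state_norm (x : Hhalf * H) : C :=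
  sqrtC (half_norm x.1 ^+ 2 + `|x.2| ^+ 2).

Definition H1xH1 : set (Hhalf * H) := [set x | H1 (val x.1) /\ H1 x.2].

Definition QNR_matrix (f g : Hhalf) : 'M[C]_(1 + 1) :=
  block_mx
    0 (half_dot g f / (half_norm f * `|val g|))%:M
    (- (dot (A0 (val f)) (val g) / (half_norm f * `|val g|)))%:M
    (- (dot (in_H (D g)) (val g) / `|val g| ^+ 2))%:M.

(* The vectors of H1 are taken in Hhalf, which contains H1. *)
Definition quadratic_numerical_range : set C :=
  [set l | exists f g : Hhalf, [/\ H1 (val f), f != 0, H1 (val g), g != 0 &
    eigenvalue (QNR_matrix f g) l]].

End SecondOrder.

(* Main.v *)
From HB Require Import structures.
Require Import Defs.
From mathcomp Require Import all_boot all_order all_algebra.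
From mathcomp Require Import complex ring.
From mathcomp Require Import all_classical all_reals all_analysis.
Import Order.TTheory GRing.Theory Num.Theory.
Import numFieldNormedType.Exports.
Local Open Scope classical_set_scope.
Local Open Scope ring_scope.

(** Why the inclusions hold.

Everything rests on one lower bound. If [l] keeps a positive distance [delta]
from the quadratic numerical range, then [x <= k * (A x - l x)] in norm, first
for [x] in H_1 x H_1 and then on the whole domain of the block operator [A].
Such a bound excludes [l] from the point spectrum and from the approximate
point spectrum, which gives every inclusion into the closure.

For [x = (f, g)] in H_1 x H_1 put [a = <g, f>_(1/2)], [d = <D g, g>],
[F = |f|_(1/2)] and [G = |g|]. The eigenvalues of the matrix attached to [f]
and [g] are the roots of [P(m) = m^2 + (d/G^2) m + |a|^2/(F G)^2]. Pairing the
two components of [A x - l x] with [f] and with [g] shows that [G^2 P(l)] is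
small when [A x - l x] is: it vanishes for an eigenvector, which is the exact
inclusion for the point spectrum on H_1 x H_1. In general, dividing by the
norms to conclude that a root of [P] is near [l] is not possible when [G] tends
to 0, because the coefficients of [P] blow up. Instead, if both roots are at
distance at least [delta] from [l], then all the Taylor coefficients of
[G^2 P] at [l] are controlled by [G^2 P(l)]; hence so are the leading
coefficient [G^2] and the constant coefficient [(|a|/F)^2]. But [|a|/F] is
nearly [|l| F], so for nonzero [l] both [F] and [G] are small
([quadratic_lower_bound]). For [l = 0] the bound holds unconditionally, because
[A_0 : H_(1/2) -> H_(-1/2)] is isometric ([residual_lower_bound_H1_0]).

The bound passes to the domain of [A] because H_1 x H_1 is a core
([H1xH1_core]): approximate the second component [w] by [v] in H_1, then
define the first component by solving [A_0 f' + D v = A_0 f + D w], so that the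
second component of the image does not change at all. *)

(** * Quadratic polynomials whose roots avoid a point *)

Lemma monic_quadratic_factors {C : numClosedFieldType} (p q : C) :
  exists m1 m2, forall x, x ^+ 2 + p * x + q = (x - m1) * (x - m2).
Proof.
pose s := sqrtC (p ^+ 2 - 4 * q).
have qE : q = (p ^+ 2 - s ^+ 2) / 4 by rewrite sqrtCK; field.
by exists ((- p + s) / 2), ((- p - s) / 2) => x; rewrite qE; field.
Qed.

(** Writing [Q = (l - m1) * (l - m2)], the derivative at [l] is
[(l - m1) + (l - m2)], and each factor has norm at least [delta]. *)
Lemma quadratic_roots_away {C : numClosedFieldType} {p q l delta : C} :
  0 <= delta -> (forall m, m ^+ 2 + p * m + q = 0 -> delta <= `|l - m|) ->
  let Q := l ^+ 2 + p * l + q in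
  delta ^+ 2 <= `|Q| /\ delta * `|2 * l + p| <= 2 * `|Q|.
Proof.
move=> delta0 away; have [m1 [m2 E]] := monic_quadratic_factors p q.
have d1 : delta <= `|l - m1| by apply: away; rewrite E subrr mul0r.
have d2 : delta <= `|l - m2| by apply: away; rewrite E subrr mulr0.
have -> : 2 * l + p = (l - m1) + (l - m2).
  have := E 0; have := E 1; rewrite expr0n /= mulr0 !add0r => E1 E0.
  have -> : p = (1 ^+ 2 + p * 1 + q) - q - 1 by ring.
  by rewrite E1 E0; ring.
rewrite /= E normrM expr2 ler_pM//; split=> //.
apply: le_trans (ler_wpM2l delta0 (ler_normD _ _)) _.
rewrite mulrDr mulr_natl mulr2n lerD// ?ler_wpM2r//.
by rewrite mulrC ler_wpM2l.
Qed.

(** The scalar form of the lower bound: [e] stands for the norm of the residual,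
and the constant [k] depends on [l] and [delta] only. The proof bounds
[T = |a| / F + |l| G], whose square is at most a multiple of [T * e]. *)
Lemma quadratic_lower_bound {C : numClosedFieldType} (l delta : C) :
  l != 0 -> 0 < delta -> exists2 k : C, 0 <= k & forall a d F G e : C,
    0 < F -> 0 < G ->
    (forall m, m ^+ 2 + d / G ^+ 2 * m + a * a^* / (F * G) ^+ 2 = 0 ->
      delta <= `|l - m|) ->
    `|a - l * F ^+ 2| <= e * F -> `|- a^* - d - l * G ^+ 2| <= e * G ->
    F + G <= k * e.
Proof.
move=> l0 delta0; have l_gt0 : 0 < `|l| by rewrite normr_gt0.
set L : C := `|l|; have L0 : 0 <= L := ltW l_gt0.
pose B := 2 * ((delta + L) ^+ 2 + L ^+ 2).
have B0 : 0 <= B by rewrite mulr_ge0// addr_ge0 ?exprn_ge0 ?addr_ge0 ?ltW.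
exists ((B / delta ^+ 2 + 1) / L).
  by rewrite divr_ge0 ?ltW// ltr_wpDl// divr_ge0// exprn_ge0// ltW.
move=> a d F G e F0 G0 away eF eG.
set p := d / G ^+ 2 in away; set q := a * a^* / (F * G) ^+ 2 in away.
have [] := quadratic_roots_away (ltW delta0) away.
set Q := l ^+ 2 + p * l + q => dQ dQ'.
have FN : F != 0 by rewrite gt_eqF.
have GN : G != 0 by rewrite gt_eqF.
have e0 : 0 <= e by rewrite -(pmulr_lge0 _ F0) (le_trans _ eF).
set al := `|a| / F; have al0 : 0 <= al by rewrite divr_ge0// ltW.
set T := al + L * G; have T0 : 0 <= T by rewrite addr_ge0// mulr_ge0// ltW.
have G2 : 0 <= G ^+ 2 by rewrite exprn_ge0// ltW.
(* [G^2 Q] is the combination of the two residuals in which [d] cancels. *)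
have etaQ : G ^+ 2 * `|Q| <= T * e.
  have -> : G ^+ 2 * `|Q| =
      `|a^* * (a - l * F ^+ 2) / F ^+ 2 - l * (- a^* - d - l * G ^+ 2)|.
    rewrite -{1}(ger0_norm G2) -normrM; congr `|_|.
    by rewrite /Q /p /q; field; apply/andP.
  apply: le_trans (ler_normB _ _) _; rewrite mulrDl lerD//.
    rewrite !normrM normfV normrX (gtr0_norm F0) norm_conjC.
    rewrite ler_pdivrMr ?exprn_gt0//.
    have -> : al * e * F ^+ 2 = `|a| * (e * F) by rewrite /al; field.
    exact: ler_wpM2l.
  by rewrite normrM -mulrA [G * e]mulrC ler_wpM2l.
(* The constant coefficient, recovered from the Taylor expansion at [l]. *)
have al2 : al ^+ 2 = G ^+ 2 * (Q - l * (2 * l + p) + l ^+ 2).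
  rewrite /al expr_div_n normCK /Q /q; field; exact/andP.
have dG : delta ^+ 2 * G ^+ 2 <= T * e.
  by apply: le_trans etaQ; rewrite mulrC ler_wpM2l.
have dQ'G : delta * (G ^+ 2 * `|2 * l + p|) <= 2 * (T * e).
  rewrite mulrCA; apply: le_trans (ler_wpM2l G2 dQ') _.
  by rewrite mulrCA ler_wpM2l.
have dal : delta ^+ 2 * al ^+ 2 <= (delta + L) ^+ 2 * (T * e).
  have le1 : al ^+ 2 <=
      G ^+ 2 * `|Q| + L * (G ^+ 2 * `|2 * l + p|) + L ^+ 2 * G ^+ 2.
    rewrite -[leLHS]ger0_norm ?exprn_ge0// al2 normrM (ger0_norm G2).
    have -> : G ^+ 2 * `|Q| + L * (G ^+ 2 * `|2 * l + p|) + L ^+ 2 * G ^+ 2 =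
       G ^+ 2 * (`|Q| + L * `|2 * l + p| + L ^+ 2) by ring.
    rewrite ler_wpM2l// (le_trans (ler_normD _ _))// normrX lerD2r.
    by rewrite (le_trans (ler_normB _ _))// normrM.
  have delta_sqr_ge0 : 0 <= delta ^+ 2 by rewrite exprn_ge0// ltW.
  apply: le_trans (ler_wpM2l delta_sqr_ge0 le1) _.
  have -> : (delta + L) ^+ 2 * (T * e) =
    delta ^+ 2 * (T * e) + L * delta * (2 * (T * e)) + L ^+ 2 * (T * e) by ring.
  rewrite !mulrDr !lerD//.
  - exact: ler_wpM2l.
  - have -> x : delta ^+ 2 * (L * x) = L * delta * (delta * x) by ring.
    by rewrite ler_wpM2l// mulr_ge0// ltW.
  - by rewrite mulrCA ler_wpM2l ?exprn_ge0.
have T2 : delta ^+ 2 * T ^+ 2 <= B * (T * e).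
  have le2 : T ^+ 2 <= 2 * (al ^+ 2 + L ^+ 2 * G ^+ 2).
    rewrite -subr_ge0.
    have -> : 2 * (al ^+ 2 + L ^+ 2 * G ^+ 2) - T ^+ 2 = (al - L * G) ^+ 2.
      by rewrite /T; ring.
    by rewrite real_exprn_even_ge0// realB ?ger0_real// mulr_ge0// ltW.
  have delta_sqr_ge0 : 0 <= delta ^+ 2 by rewrite exprn_ge0// ltW.
  apply: le_trans (ler_wpM2l delta_sqr_ge0 le2) _.
  rewrite mulrCA /B -[leRHS]mulrA ler_wpM2l// [in leRHS]mulrDl mulrDr lerD//.
  by rewrite mulrCA ler_wpM2l ?exprn_ge0.
have TB : T <= B / delta ^+ 2 * e.
  have [->|TN] := eqVneq T 0.
    by rewrite mulr_ge0// divr_ge0// exprn_ge0// ltW.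
  rewrite mulrAC ler_pdivlMr ?exprn_gt0// mulrC.
  have Tp : 0 < T by rewrite lt_def TN.
  by rewrite -(ler_pM2r Tp) -(mulrA B) (mulrC e) -mulrA -expr2.
rewrite mulrAC ler_pdivlMr// !mulrDl mul1r (mulrC F) (mulrC G).
have LF : L * F <= al + e.
  rewrite -(ler_pM2r F0) mulrDl /al divfK// -mulrA -expr2.
  rewrite -[leLHS]ger0_norm ?mulr_ge0 ?exprn_ge0 ?(ltW F0)// normrM normr_id.
  rewrite -normrM.
  have -> : l * F ^+ 2 = a - (a - l * F ^+ 2) by ring.
    by rewrite (le_trans (ler_normB _ _))// lerD2l.
apply: le_trans (lerD LF (lexx (L * G))) _.
by rewrite addrAC lerD2r.
Qed.

(** * Matrices, inner products and topology *)

Lemma eigenvalue_block_mx11 (F : fieldType) (a b c m : F) :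
  eigenvalue (block_mx 0 a%:M b%:M c%:M : 'M[F]_(1 + 1)) m =
  (m * (m - c) - a * b == 0).
Proof.
rewrite /eigenvalue /eigenspace kermx_eq0 row_free_unit unitmxE unitfE negbK.
rewrite (expand_det_row _ ord0) 2!big_ord_recl big_ord0 /cofactor.
rewrite !det_mx11.
do !(rewrite !mxE; case: splitP => -[[|//] ?] //= _).
rewrite !mxE /= /bump /=; congr (_ == 0); ring.
Qed.

(** Stated without any dimension hypothesis; positivity of the squared norm of
[x] minus its projection on the line of [y]. *)
Lemma cauchy_schwarz {C : numClosedFieldType} {H : normedModType C}
    (dot : {dot H for Num.conj}) (x y : H) :
  (forall z, dot z z = `|z| ^+ 2) -> `|dot x y| <= `|x| * `|y|.
Proof.
move=> dotE; have [->|y0] := eqVneq y 0.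
  by rewrite linear0r !normr0 mulr0.
have ny : 0 < `|y| ^+ 2 by rewrite exprn_gt0 ?normr_gt0.
rewrite -(ler_pXn2r (n := 2))// ?nnegrE ?mulr_ge0// exprMn -ler_pdivrMr//.
have [c cE] : exists c, c = dot x y / `|y| ^+ 2 by eexists.
have yx : dot y x = (dot x y)^* by rewrite (@hermC _ _ _ _ dot) expr0 mul1r.
have cy : c * `|y| ^+ 2 = dot x y by rewrite cE divfK ?gt_eqF.
rewrite normCK mulrAC -cE -subr_ge0.
have := exprn_ge0 2 (normr_ge0 (x - c *: y)); congr (0 <= _).
rewrite -dotE linearBl !linearBr /= !linearZr_LR !linearZl_LR /= !dotE yx.
rewrite cy; ring.
Qed.

(** When [nU] vanishes identically the constant in [bounded_map] is arbitrary,
possibly negative or not real; estimates need a positive one. *)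
Lemma bounded_map_gt0 {C : numDomainType} {U V : Type} {nU : U -> C}
    {nV : V -> C} {f : U -> V} :
  (forall x, 0 <= nU x) -> (forall y, 0 <= nV y) -> bounded_map nU nV f ->
  exists2 M : C, 0 < M & forall x, nV (f x) <= M * nU x.
Proof.
move=> nU0 nV0 [M Mf]; exists (`|M| + 1) => [|x]; first by rewrite ltr_wpDl.
apply: le_trans (Mf x) _; rewrite -[leLHS]ger0_norm ?(le_trans _ (Mf x))//.
by rewrite normrM [`|nU x|]ger0_norm// ler_wpM2r// lerDl.
Qed.

Lemma not_closure {C : numFieldType} {V : normedModType C} (W : set V) (l : V) :
  ~ closure W l -> exists2 e : C, 0 < e & forall m, W m -> e <= `|l - m|.
Proof.
move=> ncl; apply: contrapT => noe; apply: ncl => B /nbhs_ballP[e /= e0 eB].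
apply: contrapT => nWB; apply: noe; exists e => // m Wm.
rewrite real_leNgt ?(gtr0_real e0) ?normr_real//; apply/negP => lme; apply: nWB.
by exists m; split => //; apply: eB; rewrite -ball_normE.
Qed.

(** * Partially defined operators as total maps on their domain *)

(** An operator is linear only on its domain; on the type of elements of that
domain it is a genuine linear map. Applied to the square root of [A0], its
norm is the norm of H_(1/2). *)
Definition on_dom {R : nzRingType} {U V : lmodType R} (T : linear_operator U V)
  (x : domain T) : V := T (val x).

Section OnDomain.
Context {R : nzRingType} {U V : lmodType R} (T : linear_operator U V).

Lemma domP (x : domain T) : dom T (val x).
Proof. by have := dvalP x; rewrite unfold_in => /set_mem. Qed.

Lemma dom_val x : dom T x -> exists u : domain T, val u = x.
Proof.
move=> Tx; have h : x \in dom_pred T by rewrite unfold_in; exact/mem_set.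
by exists (Domain h).
Qed.

Lemma on_dom_is_linear : linear (on_dom T).
Proof. by move=> a x y; rewrite /on_dom linearP op_linearP//; exact: domP. Qed.

HB.instance Definition _ :=
  GRing.isLinear.Build R (domain T) V *:%R (on_dom T) on_dom_is_linear.

Lemma op_at0 : T 0 = 0.
Proof.
have v0 : val (0 : domain T) = 0 by exact: raddf0.
by rewrite -{1}v0; exact: (raddf0 (on_dom T)).
Qed.

End OnDomain.

(** * The square root of A0 and the extrapolation space *)

Section Setting.
Context {C : numClosedFieldType} {H : completeNormedModType C}.
Context (dot : {dot H for Num.conj}).
Hypothesis dotE : forall x, dot x x = `|x| ^+ 2.
Context {A0 S : linear_operator H H}.
Hypothesis A0_resolvent : resolvent_set A0 0.
Hypothesis S_sqrt : positive_sqrt dot A0 S.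

Lemma dom_A0E x : dom A0 x <-> dom S x /\ dom S (S x).
Proof. by have [_ _ -> _] := S_sqrt. Qed.

Lemma sqrt_sqrt x : dom A0 x -> S (S x) = A0 x.
Proof. by have [_ _ _] := S_sqrt; exact. Qed.

Lemma sqrt_symmetric x y : dom S x -> dom S y -> dot (S x) y = dot x (S y).
Proof.
have [[_ SE] _ _ _] := S_sqrt; move=> Sx Sy.
have : graph S (y, S y) by [].
by rewrite SE; exact.
Qed.

Lemma A0_surj y : exists2 x, dom A0 x & A0 x = y.
Proof.
have [B [_ BK _]] := A0_resolvent; have [] := BK y.
by rewrite scale0r subr0; exists (B y).
Qed.

Lemma A0_eq0 x : dom A0 x -> A0 x = 0 -> x = 0.
Proof.
have [B [_ _ KB]] := A0_resolvent => /KB + A0x.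
by rewrite A0x scale0r subr0 linear0.
Qed.

(** [S u = 0] puts [u] in the domain of [A0], where [A0 u = S (S u) = 0]. *)
Lemma sqrt_inj : {in dom S &, injective S}.
Proof.
move=> x y /set_mem /dom_val[u <-] /set_mem /dom_val[v <-] E.
apply/eqP; rewrite -subr_eq0 -raddfB; apply/eqP.
have S0 : S (val (u - v)) = 0.
  rewrite -[LHS]/(on_dom S (u - v)) raddfB.
  by apply/eqP; rewrite subr_eq0; exact/eqP.
have A0uv : dom A0 (val (u - v)).
  by apply/dom_A0E; rewrite S0; split; [exact: domP|exact: op_dom0].
by apply: A0_eq0 => //; rewrite -sqrt_sqrt// S0 op_at0.
Qed.

Lemma dom_A0_on_dom (u : Hhalf S) : dom A0 (val u) <-> dom S (on_dom S u).
Proof. by rewrite dom_A0E; split=> [[]//|]; split=> //; exact: domP. Qed.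

Lemma sqrt_surj y : exists u : Hhalf S, on_dom S u = y.
Proof.
have [x A0x <-] := A0_surj y; have [Sx SSx] := (dom_A0E x).1 A0x.
have [u uE] := dom_val S _ SSx.
by exists u; rewrite /on_dom uE sqrt_sqrt.
Qed.

(** With [y = S u] and [z = A0^-1 y], one has [S z = u], hence
[|u|^2 = <u, S z> = <y, A0^-1 y>], which is bounded by a multiple of
[|y|^2]. *)
Lemma sqrt_bounded_below : exists2 K : C, 0 < K &
  forall u : Hhalf S, `|val u| <= K * `|on_dom S u|.
Proof.
have [B [/bounded_map_gt0 [//|//|M M0 BM] BK _]] := A0_resolvent.
exists (M + 1) => [|u]; first by rewrite ltr_wpDl// ltW.
set y := on_dom S u.
have [] := BK y; rewrite scale0r subr0 => A0By A0B.
have [SB SSB] := (dom_A0E _).1 A0By.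
have SBE : S (B y) = val u.
  apply: sqrt_inj; rewrite ?inE//; first exact: domP.
  by rewrite sqrt_sqrt.
rewrite -(ler_pXn2r (n := 2))// ?nnegrE ?mulr_ge0 ?addr_ge0 ?(ltW M0)//.
have E : `|val u| ^+ 2 = dot y (B y).
  by rewrite -dotE -{2}SBE -sqrt_symmetric//; exact: domP.
rewrite -[leLHS]ger0_norm ?exprn_ge0// E.
apply: le_trans (cauchy_schwarz dot _ _ dotE) _.
apply: le_trans (ler_wpM2l (normr_ge0 _) (BM y)) _.
rewrite mulrCA exprMn -expr2 ler_wpM2r ?exprn_ge0// sqrrD1 -addrA.
rewrite ler_wpDl ?exprn_ge0 ?(ltW M0)// mulr2n -addrA lerDl.
by rewrite addr_ge0// ltW.
Qed.

Lemma minus_half_normE (u : Hhalf S) :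
  minus_half_norm S (on_dom S u) = `|val u|.
Proof.
rewrite /minus_half_norm /on_dom pinvKV ?inE//; [exact: sqrt_inj|exact: domP].
Qed.

Context {Hm : completeNormedModType C} (j : {linear H -> Hm}).
Hypothesis j_completion : is_completion (minus_half_norm S) j.

Lemma norm_j (u : Hhalf S) : `|j (on_dom S u)| = `|val u|.
Proof. by rewrite j_completion.1 minus_half_normE. Qed.

Lemma j_inj : injective j.
Proof.
move=> x y /eqP; rewrite -subr_eq0 -raddfB; have [u uE] := sqrt_surj (x - y).
rewrite -uE -normr_eq0 norm_j normr_eq0 => /eqP u0.
have u0' : u = 0 by apply: val_inj; exact: etrans u0 (esym (raddf0 val)).
by apply/eqP; rewrite -subr_eq0 -uE u0' raddf0.
Qed.

Lemma in_HK x : in_H j (j x) = x.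
Proof. by rewrite /in_H pinvKV ?inE// => ? ? _ _; exact: j_inj. Qed.

Lemma in_H0 : in_H j 0 = 0.
Proof. by rewrite -{1}(raddf0 j) in_HK. Qed.

Lemma j_bounded : exists2 K : C, 0 < K & forall x, `|j x| <= K * `|x|.
Proof.
have [K K0 HK] := sqrt_bounded_below; exists K => // x.
by have [u <-] := sqrt_surj x; rewrite norm_j.
Qed.

(** [S] maps the domain of [A0] onto its own domain, which is dense in [H]; the
norm of H_(1/2) is the norm of [H] transported by [S]. *)
Lemma Hhalf_density (u : Hhalf S) (e : C) : 0 < e ->
  exists2 v : Hhalf S, dom A0 (val v) & `|on_dom S (u - v)| < e.
Proof.
move=> e0; have [[dS _] _ _ _] := S_sqrt.
have [||y [yb Sy]] := dS (ball (on_dom S u) e).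
- by exists (on_dom S u); exact: ballxx.
- exact: ball_open.
have [v vE] := sqrt_surj y; exists v; first by apply/dom_A0_on_dom; rewrite vE.
by move: yb; rewrite raddfB /= vE -ball_normE.
Qed.

Lemma half_bounded {f : Hhalf S -> Hm} :
  bounded_map (@half_norm _ _ S) Num.norm f ->
  exists2 M : C, 0 < M & forall u, `|f u| <= M * `|on_dom S u|.
Proof. by apply: bounded_map_gt0 => ?; exact: normr_ge0. Qed.

Context (A0e D : {linear Hhalf S -> Hm}).
Hypothesis A0e_bounded : bounded_map (@half_norm _ _ S) Num.norm A0e.
Hypothesis A0e_extends : extends_A0 A0 j A0e.
Hypothesis D_bounded : bounded_map (@half_norm _ _ S) Num.norm D.
Hypothesis D_H1 : forall z : Hhalf S, H1 A0 (val z) -> range j (D z).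

(** On [H1], [A0 u = S (S u)] and the norm of H_(-1/2) undoes one [S]. *)
Lemma A0e_norm_H1 (u : Hhalf S) : H1 A0 (val u) -> `|A0e u| = `|on_dom S u|.
Proof.
move=> A0u; rewrite A0e_extends// -sqrt_sqrt//.
have [v vE] := dom_val S (S (val u)) ((dom_A0_on_dom u).1 A0u).
by rewrite -vE norm_j vE.
Qed.

(** By boundedness of [A0e] and density of [H1], the isometry extends to all of
H_(1/2). *)
Lemma A0e_bounded_below (u : Hhalf S) : `|on_dom S u| <= `|A0e u|.
Proof.
have [M M0 AM] := half_bounded A0e_bounded.
apply/ler_addgt0Pr => e e0.
have M1 : 0 < M + 1 by rewrite ltr_wpDl// ltW.
have [v A0v uv] := Hhalf_density u _ (divr_gt0 e0 M1).
have -> : on_dom S u = on_dom S v + on_dom S (u - v).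
  by rewrite -raddfD addrC subrK.
apply: le_trans (ler_normD _ _) _.
have -> : `|on_dom S v| = `|A0e u - A0e (u - v)|.
  by rewrite -raddfB opprB addrC subrK A0e_norm_H1.
apply: le_trans (lerD (ler_normB _ _) (lexx _)) _; rewrite -addrA lerD2l.
apply: le_trans (lerD (AM _) (lexx _)) _.
rewrite -[leRHS](divfK (lt0r_neq0 M1)) [leRHS]mulrC mulrDl mul1r.
by rewrite lerD ?ler_wpM2l ?ltW.
Qed.

(** * The block operator and its residuals *)

Lemma val0 : val (0 : Hhalf S) = 0.
Proof. exact: raddf0. Qed.

(** Equivalent to the Hilbert norm [state_norm], and free of square roots. *)
Definition sum_norm (x : Hhalf S * H) : C := half_norm x.1 + `|x.2|.

Lemma residual_norm (l : C) (f w : Hhalf S) :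
  sum_norm (block_op j A0e D (f, val w) - l *: (f, val w)) =
  `|on_dom S (w - l *: f)| + `|in_H j (- A0e f - D w) - l *: val w|.
Proof. by rewrite /block_op /= valKd. Qed.

Lemma j_in_H (y : Hm) : range j y -> j (in_H j y) = y.
Proof. by move=> [h _ <-]; rewrite in_HK. Qed.

Lemma in_H_block (f g : Hhalf S) : H1 A0 (val f) -> H1 A0 (val g) ->
  in_H j (- A0e f - D g) = - A0 (val f) - in_H j (D g).
Proof.
move=> A0f A0g; have [h _ hE] := D_H1 g A0g.
by rewrite A0e_extends// -hE -raddfN -raddfB !in_HK.
Qed.

Lemma half_norm_eq0 (f : Hhalf S) : half_norm f = 0 -> f = 0.
Proof.
move=> /eqP; rewrite normr_eq0 => /eqP Sf.
apply: val_inj; rewrite val0; apply: sqrt_inj.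
- by rewrite inE; exact: domP.
- by rewrite inE; exact: op_dom0.
- by rewrite op_at0.
Qed.

Lemma half_norm_gt0 (f : Hhalf S) : f != 0 -> 0 < half_norm f.
Proof.
move=> f0; rewrite lt_def normr_ge0 andbT.
by apply: contra f0 => /eqP/half_norm_eq0 ->.
Qed.

Lemma norm_val_gt0 (g : Hhalf S) : g != 0 -> 0 < `|val g|.
Proof.
move=> g0; rewrite normr_gt0; apply: contra g0 => /eqP g0.
by apply/eqP/val_inj; rewrite g0 val0.
Qed.

Lemma dot_A0 (f g : Hhalf S) : H1 A0 (val f) ->
  dot (A0 (val f)) (val g) = (half_dot dot g f)^*.
Proof.
move=> A0f; rewrite -sqrt_sqrt// sqrt_symmetric; last exact: domP.
  by rewrite (@hermC _ _ _ _ dot) expr0 mul1r.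
exact/dom_A0_on_dom.
Qed.

(** The first component of the residual, paired with [f] in H_(1/2). *)
Lemma half_dot_residual (l : C) (f g : Hhalf S) :
  half_dot dot g f - l * half_norm f ^+ 2 =
  dot (on_dom S (g - l *: f)) (on_dom S f).
Proof.
have -> : on_dom S (g - l *: f) = on_dom S g - l *: on_dom S f.
  by rewrite linearB linearZ.
by rewrite linearBl linearZl_LR /= dotE.
Qed.

(** The second component of the residual, paired with [g] in [H]. *)
Lemma dot_residual (l : C) (f g : Hhalf S) :
  H1 A0 (val f) -> H1 A0 (val g) ->
  - (half_dot dot g f)^* - dot (in_H j (D g)) (val g) - l * `|val g| ^+ 2 =
  dot (in_H j (- A0e f - D g) - l *: val g) (val g).
Proof.
move=> A0f A0g; rewrite in_H_block// !linearBl linearNl linearZl_LR /= dotE.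
by rewrite dot_A0.
Qed.

Let W2 := quadratic_numerical_range dot A0 j D.

(** The hypothesis on [m] is the characteristic equation of the matrix attached
to [f] and [g]. *)
Lemma quadratic_numerical_range_root (f g : Hhalf S) (m : C) :
  H1 A0 (val f) -> H1 A0 (val g) -> f != 0 -> g != 0 ->
  m ^+ 2 + dot (in_H j (D g)) (val g) / `|val g| ^+ 2 * m +
    half_dot dot g f * (half_dot dot g f)^* / (half_norm f * `|val g|) ^+ 2
    = 0 -> W2 m.
Proof.
move=> A0f A0g f0 g0 m0; exists f, g; split=> //.
rewrite /QNR_matrix eigenvalue_block_mx11 dot_A0//; apply/eqP; rewrite -m0.
field; apply/andP; split; rewrite gt_eqF//.
  exact: norm_val_gt0.
exact: half_norm_gt0.
Qed.

(** Second components lie in [H]; this lifts them to H_(1/2). *)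
Lemma H1xH1_ind (P : Hhalf S * H -> Prop) :
  (forall f g : Hhalf S, H1 A0 (val f) -> H1 A0 (val g) -> P (f, val g)) ->
  forall x, H1xH1 A0 x -> P x.
Proof.
move=> HP [f g0] [/= A0f A0g].
have [g gE] := dom_val S _ ((dom_A0E _).1 A0g).1.
by rewrite -gE; apply: HP => //; rewrite gE.
Qed.

(** For [l = 0] the first component of the residual is [g] itself, measured in
H_(1/2), and [f] is recovered from [A0 f = - D g - v], where [v] is the second
component. *)
Lemma residual_lower_bound_H1_0 : exists2 k : C, 0 <= k &
  forall x, H1xH1 A0 x ->
    sum_norm x <= k * sum_norm (block_op j A0e D x - 0 *: x).
Proof.
have [K K0 SK] := sqrt_bounded_below.
have [J J0 HJ] := j_bounded; have [M M0 HM] := half_bounded D_bounded.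
exists (K + J + M); first by rewrite !addr_ge0// ltW.
apply: H1xH1_ind => f g A0f A0g; rewrite residual_norm !scale0r !subr0.
have jE : j (in_H j (- A0e f - D g)) = - A0e f - D g.
  apply: j_in_H; have [h _ <-] := D_H1 g A0g.
  by exists (- A0 (val f) - h) => //; rewrite A0e_extends// raddfB raddfN.
set v := in_H j _ in jE *.
have fE : half_norm f <= J * `|v| + M * `|on_dom S g|.
  rewrite -[half_norm f]/`|on_dom S f| -A0e_norm_H1//.
  have -> : A0e f = - j v - D g by rewrite jE opprB opprK addrAC subrr add0r.
  by rewrite (le_trans (ler_normB _ _))// normrN lerD.
rewrite /sum_norm /=; apply: le_trans (lerD fE (SK g)) _; rewrite -subr_ge0.
have s0 := normr_ge0 (on_dom S g); have t0 := normr_ge0 v.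
set s := `|on_dom S g| in s0 *; set t := `|v| in t0 *.
have -> : (K + J + M) * (s + t) - (J * t + M * s + K * s) =
  J * s + K * t + M * t by ring.
by rewrite !addr_ge0// mulr_ge0// ltW.
Qed.

(** When [f] or [g] vanishes no matrix is attached to the pair, but then the
first component of the residual alone, [g - l f] in H_(1/2), bounds the other
entry. *)
Lemma residual_lower_bound_H1 (l delta : C) :
  0 < delta -> (forall m, W2 m -> delta <= `|l - m|) ->
  exists2 k : C, 0 <= k & forall x, H1xH1 A0 x ->
    sum_norm x <= k * sum_norm (block_op j A0e D x - l *: x).
Proof.
move=> delta0 away; have [->|l0] := eqVneq l 0.
  exact: residual_lower_bound_H1_0.
have [K K0 SK] := sqrt_bounded_below.
have [k k0 Hk] := quadratic_lower_bound l delta l0 delta0.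
have li0 : 0 <= `|l|^-1 by rewrite invr_ge0.
exists (K + `|l|^-1 + k); first by rewrite !addr_ge0// ltW.
apply: H1xH1_ind => f g A0f A0g; rewrite residual_norm /sum_norm /=.
set u := on_dom S _; set v := in_H j _ - _; set e := _ + `|v|.
have e0 : 0 <= e by exact: addr_ge0.
have ue : `|u| <= e by rewrite lerDl.
have ve : `|v| <= e by rewrite lerDr.
have [f0|f0] := eqVneq f 0.
  have -> : half_norm f = 0.
    by rewrite f0 -[LHS]/`|on_dom S 0| raddf0 normr0.
  have uE : u = on_dom S g by rewrite /u f0 scaler0 subr0.
  rewrite add0r; apply: le_trans (SK g) _; rewrite -uE.
  apply: le_trans (ler_wpM2l (ltW K0) ue) _.
  by rewrite ler_wpM2r// -addrA lerDl addr_ge0.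
have [g0|g0] := eqVneq g 0.
  have -> : `|val g| = 0 by rewrite g0 val0 normr0.
  have uE : `|u| = `|l| * half_norm f.
    by rewrite /u g0 sub0r -scaleNr linearZ normrZ normrN.
  have -> : half_norm f = `|l|^-1 * `|u| by rewrite uE mulKf ?normr_eq0.
  rewrite addr0; apply: le_trans (ler_wpM2l li0 ue) _.
  by rewrite ler_wpM2r// [K + _]addrC -addrA lerDl addr_ge0// ltW.
apply: (@le_trans _ _ (k * e)); last first.
  by rewrite ler_wpM2r// lerDr addr_ge0// ltW.
apply: (Hk (half_dot dot g f) (dot (in_H j (D g)) (val g))).
- exact: half_norm_gt0.
- exact: norm_val_gt0.
- by move=> m m0; apply: away; exact: quadratic_numerical_range_root m0.
- rewrite half_dot_residual; apply: le_trans (cauchy_schwarz dot _ _ dotE) _.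
  by rewrite ler_wpM2r.
- rewrite dot_residual//; apply: le_trans (cauchy_schwarz dot _ _ dotE) _.
  by rewrite ler_wpM2r.
Qed.

Lemma sum_norm_ge0 x : 0 <= sum_norm x.
Proof. exact: addr_ge0 (normr_ge0 _) (normr_ge0 _). Qed.

Lemma sum_normD x y : sum_norm (x + y) <= sum_norm x + sum_norm y.
Proof.
rewrite /sum_norm addrACA lerD ?ler_normD//.
rewrite -[half_norm _]/`|on_dom S (x.1 + y.1)| raddfD; exact: ler_normD.
Qed.

Lemma sum_normZ a x : sum_norm (a *: x) = `|a| * sum_norm x.
Proof.
have hZ : half_norm (a *: x.1) = `|a| * half_norm x.1.
  by rewrite -[LHS]/`|on_dom S (a *: x.1)| linearZ normrZ.
by rewrite /sum_norm hZ normrZ mulrDr.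
Qed.

(** The core property: approximate [w] by [v] in [H1] and
solve [A0 f' = h - h'], where [h] and [h'] represent [A0 f + D w] and [D v].
The second components of the images of [(f, w)] and [(f', v)] then agree, and
[A0 (f - f') = - D (w - v)] makes [f'] close to [f]. *)
Lemma H1xH1_core x (e : C) : dom (block_op j A0e D) x -> 0 < e ->
  exists2 y, H1xH1 A0 y & sum_norm (x - y) <= e /\
    sum_norm (block_op j A0e D x - block_op j A0e D y) <= e.
Proof.
case: x => f w0 [w [/= <- [h _ hE]]] e0.
have [K K0 SK] := sqrt_bounded_below; have [M M0 HM] := half_bounded D_bounded.
have c0 : 0 < 1 + (M + K) by rewrite !addr_gt0.
set c := 1 + _ in c0; pose d := e / c.
have d0 : 0 < d by exact: divr_gt0.
have ecd : e = c * d by rewrite mulrC divfK// gt_eqF.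
have [v A0v wv] := Hhalf_density w _ d0.
have [h' _ hE'] := D_H1 v A0v; have [z A0z zE] := A0_surj (h - h').
have [f' fE'] := dom_val S _ ((dom_A0E z).1 A0z).1.
have A0f' : H1 A0 (val f') by rewrite /H1 fE'.
have A0ef' : A0e f' = j h - D v by rewrite A0e_extends// fE' zE raddfB /= hE'.
exists (f', val v); first by split.
rewrite /block_op /= !valKd.
have -> : - A0e f' - D v = - A0e f - D w.
  by rewrite A0ef' opprB addrAC subrr sub0r hE opprD.
have wvd : `|on_dom S (w - v)| <= d by exact: ltW.
have ffd : half_norm (f - f') <= M * d.
  apply: le_trans (A0e_bounded_below _) _.
  have -> : A0e (f - f') = - D (w - v).
    by rewrite !raddfB /= A0ef' hE !opprB opprD addrCA addNKr opprK addrC.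
  by rewrite normrN (le_trans (HM _))// ler_wpM2l// ltW.
split; rewrite /sum_norm /=.
  rewrite ecd mulrDl mul1r ler_wpDl ?(ltW d0)// mulrDl lerD// -(raddfB val).
  by rewrite (le_trans (SK _))// ler_wpM2l// ltW.
rewrite subrr normr0 addr0 ecd mulrDl mul1r (le_trans wvd)// lerDl.
by apply: mulr_ge0; rewrite ?addr_ge0 ?(ltW M0) ?(ltW K0) ?(ltW d0).
Qed.

Lemma residual_lower_bound_core (l k : C) : 0 <= k ->
  (forall x, H1xH1 A0 x ->
    sum_norm x <= k * sum_norm (block_op j A0e D x - l *: x)) ->
  forall x, dom (block_op j A0e D) x ->
    sum_norm x <= k * sum_norm (block_op j A0e D x - l *: x).
Proof.
move=> k0 Hk x Ax; apply/ler_addgt0Pr => e e0.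
set A := block_op j A0e D in Hk Ax *.
have c0 : 0 < 1 + k * (1 + `|l|) by rewrite ltr_wpDr// mulr_ge0// addr_ge0.
set c := 1 + _ in c0; pose d := e / c.
have ecd : e = c * d by rewrite mulrC divfK// gt_eqF.
have [y yH1 [xy Axy]] := H1xH1_core x d Ax (divr_gt0 e0 c0).
have xE : x = y + (x - y) by rewrite addrC subrK.
have yE : A y - l *: y = (A x - l *: x) + ((-1) *: (A x - A y) + l *: (x - y)).
  rewrite scaleN1r opprB scalerBr addrACA [A x + _]addrCA subrr addr0.
  by rewrite addKr.
rewrite {1}xE; apply: le_trans (sum_normD _ _) _.
apply: le_trans (lerD (Hk _ yH1) xy) _.
rewrite yE.
have le1 : sum_norm ((-1) *: (A x - A y) + l *: (x - y)) <= (1 + `|l|) * d.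
  apply: le_trans (sum_normD _ _) _.
  rewrite !sum_normZ normrN1 mul1r mulrDl mul1r.
  by rewrite lerD// ler_wpM2l.
apply: le_trans (lerD (ler_wpM2l k0 (sum_normD _ _)) (lexx _)) _.
rewrite mulrDr -addrA lerD2l ecd mulrDl mul1r addrC lerD2l -mulrA.
exact: ler_wpM2l.
Qed.

(** * From the lower bound to the spectra *)

Lemma state_norm_ge0 (x : Hhalf S * H) : 0 <= state_norm x.
Proof. by rewrite sqrtC_ge0 addr_ge0 ?exprn_ge0//; exact: normr_ge0. Qed.

Lemma state_norm_le_sum_norm x : state_norm x <= sum_norm x.
Proof.
have F0 : 0 <= half_norm x.1 by exact: normr_ge0.
rewrite -(ler_pXn2r (n := 2))// ?nnegrE ?sqrtC_ge0 ?addr_ge0 ?exprn_ge0//.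
by rewrite sqrtCK sqrrD lerD2r lerDl mulrn_wge0// mulr_ge0.
Qed.

Lemma sum_norm_le_state_norm x : sum_norm x <= 2 * state_norm x.
Proof.
have F0 : 0 <= half_norm x.1 by exact: normr_ge0.
have le a : 0 <= a -> a ^+ 2 <= half_norm x.1 ^+ 2 + `|x.2| ^+ 2 ->
    a <= state_norm x.
  move=> a0 ale; rewrite -(ler_pXn2r (n := 2))// ?nnegrE//.
    by rewrite sqrtCK.
  by rewrite sqrtC_ge0 addr_ge0 ?exprn_ge0.
rewrite mulr_natl mulr2n lerD// le// ?lerDl ?lerDr exprn_ge0//.
Qed.

Lemma sum_norm_eq0 x : sum_norm x = 0 -> x = 0.
Proof.
case: x => f h /eqP; rewrite paddr_eq0 //=; last exact: normr_ge0.
by move=> /andP[/eqP/half_norm_eq0 ->]; rewrite normr_eq0 => /eqP ->.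
Qed.

Lemma point_spectrum_lower_bound (l k : C) :
  (forall x, dom (block_op j A0e D) x ->
    sum_norm x <= k * sum_norm (block_op j A0e D x - l *: x)) ->
  ~ point_spectrum (block_op j A0e D) l.
Proof.
move=> Hk [x [Ax /eqP x0 xE]]; apply: x0; apply: sum_norm_eq0.
apply: le_anti; rewrite sum_norm_ge0 andbT.
have := Hk x Ax; rewrite xE subrr -(scale0r x) sum_normZ normr0 mul0r mulr0.
exact.
Qed.

Lemma approximate_point_spectrum_lower_bound (l k : C) : 0 <= k ->
  (forall x, dom (block_op j A0e D) x ->
    sum_norm x <= k * sum_norm (block_op j A0e D x - l *: x)) ->
  ~ approximate_point_spectrum (@state_norm _ _ S) (block_op j A0e D) l.
Proof.
move=> k0 Hk [x [Ax x1 /cvgr0Pnorm_lt xl]].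
have K0 : 0 < 2 * (k + 1) by rewrite mulr_gt0// ltr_wpDl.
have Ki0 : 0 < (2 * (k + 1))^-1 by rewrite invr_gt0.
have [N _ /(_ _ (leqnn N)) /=] := xl _ Ki0.
set r := state_norm _ => rl.
have : 1 <= k * (2 * `|r|).
  rewrite -[leLHS](x1 N) (le_trans (state_norm_le_sum_norm _))//.
  rewrite (le_trans (Hk _ (Ax N)))//.
  rewrite ler_wpM2l// (le_trans (sum_norm_le_state_norm _))// ler_wpM2l//.
  by rewrite ger0_norm ?state_norm_ge0.
apply/negP; rewrite -real_ltNge ?ger0_real ?mulr_ge0//.
have {}rl : 2 * (k + 1) * `|r| < 1 by rewrite -ltr_pdivlMl// mulr1.
rewrite mulrCA mulrA.
apply: le_lt_trans rl; by rewrite mulrDr mulr1 mulrDl lerDl mulr_ge0.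
Qed.

(** For an eigenvector the two pairings vanish exactly, and eliminating [a] and
[d] from them gives the characteristic equation at [l]. The component [f] is
nonzero because [g = l f], and [g] because [A0] is injective. *)
Lemma point_spectrum_H1xH1 :
  point_spectrum (restriction (block_op j A0e D) (@H1xH1 _ _ A0 S)) `<=` W2.
Proof.
move=> l [x [/= xH1 x0 xE]]; move: x xH1 x0 xE; apply: H1xH1_ind.
move=> f g A0f A0g x0; rewrite /= valKd => -[gf vE].
have f0 : f != 0.
  apply: contra x0 => /eqP f0; move: gf; rewrite f0 scaler0 => ->. 
  by rewrite val0.
have g0 : g != 0.
  apply/eqP => g0; move: vE; rewrite in_H_block// g0 val0 scaler0.
  rewrite (raddf0 D) in_H0 subr0 => /eqP; rewrite oppr_eq0.
  move=> /eqP /(A0_eq0 _ A0f) vf0; move: f0; apply/negP; rewrite negbK.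
  by apply/eqP/val_inj; rewrite vf0 val0.
have F0 : half_norm f != 0 by rewrite gt_eqF// half_norm_gt0.
have G0 : `|val g| != 0 by rewrite gt_eqF// norm_val_gt0.
have := dot_residual l f g A0f A0g; rewrite vE subrr linear0l.
have := half_dot_residual l f g; rewrite {2}gf subrr raddf0 linear0l.
move=> /eqP; rewrite subr_eq0 => /eqP aE /eqP.
rewrite addrAC subr_eq0 => /eqP dE.
apply: (quadratic_numerical_range_root f g) => //; rewrite -dE aE.
by field; apply/andP.
Qed.

Lemma H1xH1_dom x : H1xH1 A0 x -> dom (block_op j A0e D) x.
Proof.
move: x; apply: H1xH1_ind => f g A0f A0g; exists g; split=> //=.
have [h _ <-] := D_H1 g A0g.
by exists (A0 (val f) + h) => //; rewrite A0e_extends// raddfD.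
Qed.

Lemma not_closure_lower_bound (l : C) : ~ closure W2 l ->
  exists2 k : C, 0 <= k & forall x, dom (block_op j A0e D) x ->
    sum_norm x <= k * sum_norm (block_op j A0e D x - l *: x).
Proof.
move=> /not_closure[e e0 away].
have [k k0 Hk] := residual_lower_bound_H1 l e e0 away.
by exists k => //; exact: residual_lower_bound_core.
Qed.

Lemma quadratic_numerical_range_spectra :
  let A := block_op j A0e D in
  let A_H1xH1 := restriction A (@H1xH1 _ _ A0 S) in
  [/\ point_spectrum A_H1xH1 `<=` W2,
      approximate_point_spectrum (@state_norm _ _ S) A_H1xH1 `<=` closure W2,
      point_spectrum A `<=` closure W2 &
      approximate_point_spectrum (@state_norm _ _ S) A `<=` closure W2].
Proof.
move=> A A_H1xH1.
have apA : approximate_point_spectrum (@state_norm _ _ S) A `<=` closure W2.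
  move=> l Al; apply: contrapT => /not_closure_lower_bound[k k0 Hk].
  exact: (approximate_point_spectrum_lower_bound l k).
split => //; first exact: point_spectrum_H1xH1.
- move=> l [x [xH1 x1 xl]]; apply: apA; exists x; split=> // n.
  by apply: H1xH1_dom; exact: (xH1 n).
- move=> l Al; apply: contrapT => /not_closure_lower_bound[k _ Hk].
  exact: (point_spectrum_lower_bound l k).
Qed.

End Setting.

Local Open Scope complex_scope.

Theorem theorem5p1 (R : realType) (H : completeNormedModType R[i])
  (dot : {dot H for Num.conj})
  (dot_norm : forall x, dot x x = `|x| ^+ 2)
  (A0 : linear_operator H H)
  (A0_self_adjoint : self_adjoint dot A0)
  (A0_uniformly_positive : uniformly_positive dot A0)
  (A0_resolvent : resolvent_set A0 0)
  (S : linear_operator H H)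
  (S_sqrt : positive_sqrt dot A0 S)
  (Hm : completeNormedModType R[i]) (j : {linear H -> Hm})
  (j_completion : is_completion (minus_half_norm S) j)
  (pairing : Hm -> Hhalf S -> R[i])
  (pairing_duality : is_duality_pairing dot j pairing)
  (A0e : {linear Hhalf S -> Hm})
  (A0e_bounded : bounded_map (@half_norm _ _ S) Num.norm A0e)
  (A0e_extends : extends_A0 A0 j A0e)
  (D : {linear Hhalf S -> Hm})
  (D_bounded : bounded_map (@half_norm _ _ S) Num.norm D)
  (D_accretive : forall z, 0 <= 'Re (pairing (D z) z))
  (D_H1 : forall z : Hhalf S, H1 A0 (val z) -> range j (D z)) :
  let A := block_op j A0e D in
  let A_H1xH1 := restriction A (@H1xH1 _ _ A0 S) in
  let W2 := quadratic_numerical_range dot A0 j D in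
  [/\ point_spectrum A_H1xH1 `<=` W2,
      approximate_point_spectrum (@state_norm _ _ S) A_H1xH1 `<=` closure W2,
      point_spectrum A `<=` closure W2 &
      approximate_point_spectrum (@state_norm _ _ S) A `<=` closure W2].
Proof.
exact: (quadratic_numerical_range_spectra dot dot_norm A0_resolvent S_sqrt j).
Qed.
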